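(* Let $(\mathbf C,\mathbf E,\mathbf A,\mathbf B)$ be a minimal realization, of dimension $n$, of the linear system $\mathbf\Sigma$ with transfer function $\mathbf H(s)=\mathbf C(s\mathbf E-\mathbf A)^{-1}\mathbf B$, and let $\mathbb W,\mathbb L,\mathbb L_s,\mathbb V$ be the Loewner quadruple and $\mathcal K_L\in\mathbb C^{q\times n}$, $\mathcal K_R\in\mathbb C^{n\times k}$ the tangential rational Krylov projection matrices associated with the interpolation data (all as defined in the context, with $q,k\ge n$ and $\mathcal K_L\mathcal K_R$ of full rank, i.e. of rank $n$). Then $$\mathbb W=\mathbf C\mathcal K_R\in\mathbb C^{p\times k},\quad \mathbb L=-\mathcal K_L\mathbf E\mathcal K_R\in\mathbb C^{q\times k},\quad \mathbb L_s=-\mathcal K_L\mathbf A\mathcal K_R\in\mathbb C^{q\times k},\quad \mathbb V=\mathcal K_L\mathbf B\in\mathbb C^{q\times m}.$$ Consequently: 1. This factorization is rank revealing, and the rank of $\mathbb L$ is equal to the McMillan degree $n$ of $\mathbf\Sigma$. The entries of the Loewner quadruple $(\mathbb W,\mathbb L,\mathbb L_s,\mathbb V)$ depend on the system exclusively through values of the transfer function $\mathbf H$. Furthermore, for every $s\in\mathbb C$ such that $s\mathbf E-\mathbf A$ is invertible, $$\mathbf H(s)=\mathbb W\,(\mathbb L_s-s\,\mathbb L)^{+}\,\mathbb V ,$$ where $(\cdot)^+$ denotes the Moore-Penrose generalized inverse. 2. An explicit generalized eigenvalue decomposition of the Loewner pencil $(\mathbb L_s,\mathbb L)$ results: let $(\lambda,\hat{\mathbf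 q},\hat{\mathbf p})$ be a triple composed of an eigenvalue $\lambda$ and corresponding right and left eigenvectors of the pencil $(\mathbf A,\mathbf E)$, i.e. $\mathbf A\hat{\mathbf q}=\lambda\mathbf E\hat{\mathbf q}$, $\hat{\mathbf p}^T\mathbf A=\lambda\hat{\mathbf p}^T\mathbf E$ with $\hat{\mathbf q},\hat{\mathbf p}\ne 0$. Then $\lambda$ is also an eigenvalue of the pencil $(\mathbb L_s,\mathbb L)$, with corresponding right and left eigenvectors $$\mathbf q=\mathcal K_R^+\hat{\mathbf q}\quad\text{and}\quad \mathbf p^T=\hat{\mathbf p}^T\mathcal K_L^+,$$ i.e. $\mathbf q,\mathbf p\neq 0$, $\mathbb L_s\mathbf q=\lambda\mathbb L\mathbf q$ and $\mathbf p^T\mathbb L_s=\lambda\mathbf p^T\mathbb L$.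
   Context: The system $\mathbf\Sigma$ is $\mathbf E\dot{\mathbf x}(t)=\mathbf A\mathbf x(t)+\mathbf B\mathbf u(t)$, $\mathbf y(t)=\mathbf C\mathbf x(t)$, with $\mathbf C\in\mathbb R^{p\times n}$, $\mathbf E,\mathbf A\in\mathbb R^{n\times n}$, $\mathbf B\in\mathbb R^{n\times m}$ and $s\mathbf E-\mathbf A$ invertible for all but finitely many $s$. Put $\mathbf\Phi(s)=(s\mathbf E-\mathbf A)^{-1}$, so $\mathbf H(s)=\mathbf C\mathbf\Phi(s)\mathbf B$. Data: mutually distinct interpolation points $\mu_1,\dots,\mu_q,\lambda_1,\dots,\lambda_k\in\mathbb C$, at which $\mathbf\Phi$ is defined; left tangential directions $\boldsymbol\ell_i\in\mathbb C^p$ and right tangential directions $\mathbf r_j\in\mathbb C^m$; left values $\mathbf v_i^T=\boldsymbol\ell_i^T\mathbf H(\mu_i)$, $i=1,\dots,q$; right values $\mathbf w_j=\mathbf H(\lambda_j)\mathbf r_j$, $j=1,\dots,k$. Loewner quadruple: $\mathbb W=[\mathbf w_1\ \cdots\ \mathbf w_k]\in\mathbb C^{p\times k}$; $\mathbb V\in\mathbb C^{q\times m}$ is the matrix with rows $\mathbf v_1^T,\dots,\mathbf v_q^T$; and the Loewner and shifted Loewner matrices are $$(\mathbb L)_{i,j}=\frac{\mathbf v_i^T\mathbf r_j-\boldsymbol\ell_i^T\mathbf w_j}{\mu_i-\lambda_j},\qquad (\mathbb L_s)_{i,j}=\frac{\mu_i\mathbf v_i^T\mathbf r_j-\boldsymbol\ell_i^T\mathbf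 w_j\lambda_j}{\mu_i-\lambda_j}.$$ Krylov projection matrices: $\mathcal K_L\in\mathbb C^{q\times n}$ has rows $\boldsymbol\ell_i^T\mathbf C\mathbf\Phi(\mu_i)$, $i=1,\dots,q$; $\mathcal K_R\in\mathbb C^{n\times k}$ has columns $\mathbf\Phi(\lambda_j)\mathbf B\mathbf r_j$, $j=1,\dots,k$. It is assumed that $q,k\ge n$ and that $\mathcal K_L\mathcal K_R$ has full rank, meaning rank $n$ (so $\mathcal K_L$ has full column rank and $\mathcal K_R$ has full row rank). The results are asserted irrespective of whether the pencil $\mathbb L_s-s\mathbb L$ is singular or rectangular.
   Formalization: The rank of L is proved equal to the McMillan degree of H (poles at infinity counted) for every E, but equal to the dimension n exactly when E is invertible; for singular E (e.g. E=0, A=-1, B=C=1) a minimal realization has rank L < n. *)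

(* Defs.v *)
From mathcomp Require Import all_boot all_order all_algebra.
From mathcomp Require Import complex classical_sets reals.

Set Implicit Arguments.
Unset Strict Implicit.
Unset Printing Implicit Defensive.

Import Order.TTheory GRing.Theory Num.Theory.
Local Open Scope ring_scope.
Local Open Scope complex_scope.
Local Open Scope sesquilinear_scope.

Section MoorePenrose.
Variable K : numClosedFieldType.

(* [pinvmx] of mxalgebra is only a partial inverse on the row space, not the
   Moore-Penrose inverse. *)
Definition is_moore_penrose m n (A : 'M[K]_(m, n)) (X : 'M[K]_(n, m)) : Prop :=
  [/\ A *m X *m A = A, X *m A *m X = X,
      (A *m X)^t* = A *m X & (X *m A)^t* = X *m A].

Definition mpinv m n (A : 'M[K]_(m, n)) : 'M[K]_(n, m) :=
  xget 0 [set X | is_moore_penrose A X]%classic.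

Lemma trmxC_mul m n p (A : 'M[K]_(m, n)) (B : 'M[K]_(n, p)) :
  (A *m B)^t* = B^t* *m A^t*.
Proof. by rewrite trmx_mul map_mxM. Qed.

Lemma moore_penrose_uniq m n (A : 'M[K]_(m, n)) X Y :
  is_moore_penrose A X -> is_moore_penrose A Y -> X = Y.
Proof.
move=> [AXA XAX hAX hXA] [AYA YAY hAY hYA].
have eAX : A *m X = A *m Y.
  by rewrite -hAX -{1}AYA -(mulmxA (A *m Y)) trmxC_mul hAX hAY !mulmxA AXA.
have eXA : X *m A = Y *m A.
  rewrite -hXA -{1}AYA -(mulmxA A Y) mulmxA trmxC_mul hXA hYA.
  by rewrite -!mulmxA (mulmxA A X) AXA.
by rewrite -XAX eXA -mulmxA eAX mulmxA YAY.
Qed.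

Lemma gram_unitmx r n (G : 'M[K]_(r, n)) :
  row_free G -> G *m G^t* \in unitmx.
Proof.
move=> freeG; rewrite -row_free_unit; apply/row_freeP.
have : kermx (G *m G^t*) = 0.
  apply/row_matrixP => i; rewrite row0; set v := row i _.
  have v0 : v *m (G *m G^t*) = 0.
    by apply/sub_kermxP; rewrite row_sub.
  suff : v *m G = 0 by move/(canRL (mulmxKp freeG)); rewrite mul0mx.
  apply/eqP; rewrite -(dnorm_eq0 (@dotmx K n)); apply/eqP.
  apply: etrans (dotmxE _ _) _.
  by rewrite trmxC_mul !mulmxA -(mulmxA v) v0 mul0mx mxE.
by move/eqP; rewrite kermx_eq0 => /row_freeP.
Qed.

Lemma moore_penrose_factor m r n (F : 'M[K]_(m, r)) (G : 'M[K]_(r, n)) :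
  row_full F -> row_free G ->
  is_moore_penrose (F *m G)
    (G^t* *m invmx (G *m G^t*) *m (invmx (F^t* *m F) *m F^t*)).
Proof.
move=> fullF freeG.
have uG : G *m G^t* \in unitmx by exact: gram_unitmx.
have uF : F^t* *m F \in unitmx.
  have freeF : row_free (F^t*) by rewrite /row_free mxrank_map mxrank_tr.
  by have := gram_unitmx freeF; rewrite trmxCK.
have hermV l (M : 'M[K]_l) : M^t* = M -> (invmx M)^t* = invmx M.
  by move=> hM; rewrite trmx_inv map_invmx hM.
set X := G^t* *m _ *m _.
have AXE : F *m G *m X = F *m invmx (F^t* *m F) *m F^t*.
  by rewrite /X !mulmxA -(mulmxA F) -(mulmxA F) mulmxV // mulmx1.
have XAE : X *m (F *m G) = G^t* *m invmx (G *m G^t*) *m G.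
  rewrite /X -!mulmxA (mulmxA (F^t*)) (mulmxA (invmx (F^t* *m F))).
  by rewrite mulVmx // mul1mx.
split.
- rewrite AXE -!mulmxA (mulmxA (F^t*)) (mulmxA (invmx _)).
  by rewrite mulVmx // mul1mx.
- by rewrite XAE /X -!mulmxA (mulmxA G) (mulmxA (G *m _)) mulmxV // mul1mx.
- by rewrite AXE !trmxC_mul trmxCK hermV ?mulmxA // trmxC_mul trmxCK.
- by rewrite XAE !trmxC_mul trmxCK hermV ?mulmxA // trmxC_mul trmxCK.
Qed.

Lemma mpinvP m n (A : 'M[K]_(m, n)) : is_moore_penrose A (mpinv A).
Proof.
have := moore_penrose_factor (col_base_full A) (row_base_free A).
rewrite mulmx_base => AX.
by have := xgetPex 0 (ex_intro [set X | is_moore_penrose A X]%classic _ AX).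
Qed.

End MoorePenrose.

Record linear_system (R : realType) (p m n : nat) := LinearSystem {
  sysC : 'M[R]_(p, n);
  sysE : 'M[R]_n;
  sysA : 'M[R]_n;
  sysB : 'M[R]_(n, m) }.

Notation toC M := (map_mx (real_complex _) M).

Section Systems.
Variable R : realType.
Notation C := R[i].

Section TransferFunction.
Variables (p m n : nat) (S : linear_system R p m n).

Definition sys_pencil (s : C) : 'M[C]_n := s *: toC (sysE S) - toC (sysA S).

Definition regular_system : Prop :=
  exists bad : seq C, forall s, s \notin bad -> sys_pencil s \in unitmx.

(* As [invmx] is total, [resolvent] and [transfer] are meaningful only where
   [sys_pencil s] is invertible. *)
Definition resolvent (s : C) : 'M[C]_n := invmx (sys_pencil s).

Definition transfer (s : C) : 'M[C]_(p, m) :=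
  toC (sysC S) *m resolvent s *m toC (sysB S).

End TransferFunction.

Definition same_transfer p m n n'
    (S : linear_system R p m n) (S' : linear_system R p m n') : Prop :=
  forall s, sys_pencil S s \in unitmx -> sys_pencil S' s \in unitmx ->
    transfer S s = transfer S' s.

Definition minimal_realization p m n (S : linear_system R p m n) : Prop :=
  regular_system S /\
  forall n' (S' : linear_system R p m n'),
    regular_system S' -> same_transfer S S' -> (n <= n')%N.

(* The McMillan degree of a rational matrix is the number of its poles, the
   point at infinity included: the degree of the least common denominator of
   all its minors (of all orders) plus the largest order of a pole at infinity
   among these minors. A rational matrix is represented by a function that
   agrees with it off a finite set. *)

Section McMillan.
Variables (p m : nat) (H : C -> 'M[C]_(p, m)).

Definition minor_numerator (den : {poly C}) (k : nat)
    (f : 'I_k -> 'I_p) (g : 'I_k -> 'I_m) (num : {poly C}) : Prop :=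
  exists bad : seq C, forall s, s \notin bad ->
    den.[s] * \det (mxsub f g (H s)) = num.[s].

Definition common_denominator (den : {poly C}) : Prop :=
  den \is monic /\
  forall k (f : 'I_k -> 'I_p) (g : 'I_k -> 'I_m),
    exists num, minor_numerator den f g num.

Definition pole_polynomial (den : {poly C}) : Prop :=
  common_denominator den /\
  forall den', common_denominator den' -> den %| den'.

(* The minor num / den has a pole at infinity of order deg num - deg den. The
   minor of order 0, which is 1, makes the maximum non-negative. *)
Definition max_pole_order_infty (den : {poly C}) (e : nat) : Prop :=
  (forall k (f : 'I_k -> 'I_p) (g : 'I_k -> 'I_m) num,
     minor_numerator den f g num -> (size num <= size den + e)%N) /\
  (exists k (f : 'I_k -> 'I_p) (g : 'I_k -> 'I_m) num,
     minor_numerator den f g num /\ size num = (size den + e)%N).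

Definition mcmillan_degree (d : nat) : Prop :=
  exists den e, [/\ pole_polynomial den, max_pole_order_infty den e &
                    d = ((size den).-1 + e)%N].

End McMillan.

Record tangential_data (p m q k : nat) := TangentialData {
  lpt : 'I_q -> C;
  rpt : 'I_k -> C;
  ldir : 'I_q -> 'cV[C]_p;
  rdir : 'I_k -> 'cV[C]_m }.

Definition distinct_points p m q k (D : tangential_data p m q k) : Prop :=
  [/\ injective (lpt D), injective (rpt D) & forall i j, lpt D i != rpt D j].

Section Loewner.
Variables (p m q k : nat) (D : tangential_data p m q k).
Variable H : C -> 'M[C]_(p, m).

(* The row vector v_i^T, not the column v_i. *)
Definition left_value (i : 'I_q) : 'rV[C]_m := (ldir D i)^T *m H (lpt D i).

Definition right_value (j : 'I_k) : 'cV[C]_p := H (rpt D j) *m rdir D j.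

Definition loewnerW : 'M[C]_(p, k) := \matrix_(a, j) right_value j a 0.

Definition loewnerV : 'M[C]_(q, m) := \matrix_(i, b) left_value i 0 b.

Definition loewnerL : 'M[C]_(q, k) := \matrix_(i, j)
  (((left_value i *m rdir D j) 0 0 - ((ldir D i)^T *m right_value j) 0 0)
   / (lpt D i - rpt D j)).

Definition loewnerLs : 'M[C]_(q, k) := \matrix_(i, j)
  ((lpt D i * (left_value i *m rdir D j) 0 0
    - ((ldir D i)^T *m right_value j) 0 0 * rpt D j)
   / (lpt D i - rpt D j)).

Definition loewner_quadruple :
    'M[C]_(p, k) * 'M[C]_(q, k) * 'M[C]_(q, k) * 'M[C]_(q, m) :=
  (loewnerW, loewnerL, loewnerLs, loewnerV).

End Loewner.

Section Krylov.
Variables (p m q k n : nat) (D : tangential_data p m q k).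
Variable S : linear_system R p m n.

Definition defined_at_points : Prop :=
  (forall i, sys_pencil S (lpt D i) \in unitmx) /\
  (forall j, sys_pencil S (rpt D j) \in unitmx).

Definition krylovL : 'M[C]_(q, n) := \matrix_(i, a)
  ((ldir D i)^T *m toC (sysC S) *m resolvent S (lpt D i)) 0 a.

Definition krylovR : 'M[C]_(n, k) := \matrix_(a, j)
  (resolvent S (rpt D j) *m toC (sysB S) *m rdir D j) a 0.

End Krylov.

Definition rank_revealing q n k (M : 'M[C]_(q, k))
    (F : 'M[C]_(q, n)) (X : 'M[C]_n) (G : 'M[C]_(n, k)) : Prop :=
  [/\ M = F *m X *m G, \rank F = n, \rank G = n & \rank M = \rank X].

(* A value of s at which the rank of M - s N drops below its generic value;
   this is also meaningful for singular and rectangular pencils. *)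
Definition pencil_eigenvalue q k (M N : 'M[C]_(q, k)) (lam : C) : Prop :=
  exists s, (\rank (M - lam *: N)%R < \rank (M - s *: N)%R)%N.

Definition pencil_eigenvectors q k (M N : 'M[C]_(q, k)) (lam : C)
    (x : 'cV[C]_k) (y : 'cV[C]_q) : Prop :=
  [/\ x != 0, y != 0, M *m x = lam *: (N *m x) &
      y^T *m M = lam *: (y^T *m N)].

End Systems.

(* Main.v *)
Require Import Defs.
From mathcomp Require Import all_boot all_order all_algebra.
From mathcomp Require Import perm complex reals.
Import Order.TTheory GRing.Theory Num.Theory.
Local Open Scope ring_scope.

(**
The Loewner matrices are divided differences of the resolvent Phi taken between
the directions l_i^T C and B r_j. Writing P(s) = sE - A, the identity
  a Phi(mu) - b Phi(lambda) = Phi(mu) (a P(lambda) - b P(mu)) Phi(lambda)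
collapses to a multiple of E when a = b = 1 and to a multiple of A when
(a, b) = (mu, lambda) [resolvent_divided_difference]; this gives L = - KL E KR
and Ls = - KL A KR, hence Ls - s L = KL P(s) KR. As KL has a left inverse and
KR a right inverse, ranks and eigenvectors pass from the pencil (A, E) to
(Ls, L), and KR (KL P(s) KR)^+ KL = P(s)^-1 [mpinv_sandwich], from which H is
recovered.

The substantial claim is that rank L = rank E is the McMillan degree of H, all
poles counted, those at infinity included [mcmillan_degree_rank]. By a Schur
complement, det P(s) times a minor of H(s) is the determinant of the bordered
matrix [P(s), B_g; - C_f, 0], where f and g select the rows and columns of the
minor [det_bordered]. These determinants are polynomials in s, so det P is a
common denominator. Two facts identify it as the least one and compute the pole
order at infinity:

- at each s, some bordered matrix is invertible: controllability lets columns
  of B complete the column space of P(s), and observability lets rows of C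
  complete its row space [bordered_unitmx]. So the numerators have no common
  root, and every common denominator is a multiple of det P
  [dvdp_no_common_root];

- the numerators have degree at most rank E, because E carries all occurrences
  of s [size_pencil_det]. The bound is attained: the same completion applied to
  E in place of P(s) gives an invertible [E, B_g; - C_f, 0], whose determinant
  is the coefficient of s^(rank E) in a numerator.

Hence (deg det P) + (rank E - deg det P) = rank E. Controllability and
observability, at infinity as well as at finite points, follow from the full
rank of the Krylov matrices [krylov_controllable].
*)

Set Implicit Arguments.
Unset Strict Implicit.
Unset Printing Implicit Defensive.

(** * Determinants of matrix pencils *)

Definition pencil_det (F : comNzRingType) l (M N : 'M[F]_l) : {poly F} :=
  \det ('X *: map_mx polyC M + map_mx polyC N).

Lemma horner_pencil_det (F : comNzRingType) l (M N : 'M[F]_l) s :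
  (pencil_det M N).[s] = \det (s *: M + N).
Proof.
rewrite /pencil_det -horner_evalE -det_map_mx; congr (\det _).
by apply/matrixP => i j; rewrite !mxE /= !(hornerE, horner_evalE).
Qed.

(** Multiplying on both sides by constant invertible matrices turns [M] into a
partial identity, so that the variable occurs in only [\rank M] rows. *)
Lemma size_pencil_det (F : fieldType) l (M N : 'M[F]_l) :
  (size (pencil_det M N) <= (\rank M).+1)%N.
Proof.
set r := \rank M; set cM := col_ebase M; set rM := row_ebase M.
pose N' := invmx cM *m N *m invmx rM.
have -> : pencil_det M N =
    (\det cM)%:P * pencil_det (pid_mx r) N' * (\det rM)%:P.
  rewrite /pencil_det -!det_map_mx -!det_mulmx; congr (\det _).
  rewrite mulmxDr mulmxDl -scalemxAr -scalemxAl -!map_mxM /= mulmx_ebase.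
  by rewrite /N' !mulmxA mulmxV ?col_ebase_unit // mul1mx mulmxKV
     ?row_ebase_unit.
rewrite mulrC mulrA -polyCM mul_polyC.
apply: leq_trans (size_scale_leq _ _) _.
(* In the Leibniz expansion, entry i of each product has degree at most
   (i < r). *)
rewrite /pencil_det; apply: leq_trans (size_sum _ _ _) _.
apply/bigmax_leqP => sg _; rewrite size_Msign.
apply: leq_trans (size_poly_prod_leq _ _) _.
rewrite cardT size_enum_ord leq_subLR addnS ltnS.
have entry (i : 'I_l) : (size (('X *: map_mx polyC (pid_mx r : 'M[F]_l) +
    map_mx polyC N') i (sg i))%R <= 1 + (i < r))%N.
  rewrite !mxE; apply: leq_trans (size_polyD _ _) _.
  rewrite geq_max (leq_trans (size_polyC_leq1 _)) ?leq_addr // andbT.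
  case: (i < r)%N; last by rewrite andbF mulr0 size_poly0.
  rewrite mulrC mul_polyC; apply: leq_trans (size_scale_leq _ _) _.
  by rewrite size_polyX.
apply: leq_trans (leq_sum _ (fun i _ => entry i)) _.
rewrite big_split /= sum1_card card_ord leq_add2l.
rewrite -big_mkcond sum1_card /=.
have le_rl : (r <= l)%N by rewrite rank_leq_row.
rewrite -[X in (_ <= X)%N]card_ord.
rewrite -(card_image (f := widen_ord le_rl)); last first.
  by move=> i j /(congr1 val) /= /val_inj.
apply/subset_leq_card/fintype.subsetP => i lt_ir; apply/mapP.
by exists (Ordinal lt_ir); rewrite ?mem_enum //; apply: val_inj.
Qed.

(** * Univariate polynomials *)

Lemma exists_off_finite (F : numFieldType) (bad : seq F) (p : {poly F}) :
  p != 0 -> exists2 s, s \notin bad & ~~ root p s.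
Proof.
move=> p0; pose P := p * \prod_(b <- bad) ('X - b%:P).
have P0 : P != 0 by rewrite mulf_neq0 // monic_neq0 // monic_prod_XsubC.
pose rs : seq F := [seq i%:R | i <- iota 0 (size P)].
have uniq_rs : uniq rs.
  by rewrite map_inj_uniq ?iota_uniq // => i j /eqP; rewrite eqr_nat => /eqP.
case: (boolP (all (root P) rs)) => [rootP|].
  by have := max_poly_roots P0 rootP uniq_rs; rewrite size_map size_iota ltnn.
case/allPn => s _; rewrite rootM negb_or root_prod_XsubC => /andP [ps sb].
by exists s.
Qed.

Lemma poly_eq_off_finite (F : numFieldType) (bad : seq F) (p q : {poly F}) :
  (forall s, s \notin bad -> p.[s] = q.[s]) -> p = q.
Proof.
move=> pq; apply/eqP; rewrite -subr_eq0; apply: contraT.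
case/(exists_off_finite bad) => s sb.
by rewrite rootE !hornerE pq // subrr eqxx.
Qed.

(** [p] and [q] are mutually reversed polynomials of formal degree [d]: the
behaviour of [p] at infinity is read off at [q.[0]]. *)
Lemma coef_reversed (F : numFieldType) d (p q : {poly F}) :
  (size p <= d.+1)%N ->
  (forall s, s != 0 -> p.[s] = s ^+ d * q.[s^-1]) -> p`_d = q.[0].
Proof.
move=> size_p pq.
have <- : \poly_(i < d.+1) p`_(d - i) = q.
  apply: (@poly_eq_off_finite _ [:: 0]) => t; rewrite inE => t0.
  have := pq t^-1; rewrite invr_eq0 invrK => /(_ t0) /(canLR (mulKf _)).
  rewrite expf_neq0 ?invr_eq0 // => <- //.
  rewrite exprVn invrK (horner_coef_wide _ size_p) horner_poly.
  rewrite mulr_sumr (reindex_inj rev_ord_inj) /=.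
  apply: eq_bigr => i _; rewrite subSS (subKn (leq_ord i)) mulrCA.
  congr (_ * _); rewrite exprVn -exprB ?leq_ord //.
  by rewrite unitfE.
by rewrite horner_coef0 coef_poly subn0.
Qed.

(** Every factor of [d] missing from [d'] would divide all the cofactors [v],
and over a closed field it would give them a common root. *)
Lemma dvdp_no_common_root (F : closedFieldType) (d d' : {poly F}) :
  d != 0 -> (forall s, exists2 v, ~~ root v s & d %| d' * v) -> d %| d'.
Proof.
move=> d0 nocommon; pose G := gcdp d d'.
have G0 : G != 0 by rewrite gcdp_eq0 (negPf d0).
have dE : d = (d %/ G) * G by rewrite divpK ?dvdp_gcdl.
have d'E : d' = (d' %/ G) * G by rewrite divpK ?dvdp_gcdr.
have co : coprimep (d %/ G) (d' %/ G) by rewrite coprimep_div_gcd // d0.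
have dvd_cofactor v : d %| d' * v -> d %/ G %| v.
  by rewrite {1}dE {1}d'E mulrAC dvdp_mul2r // Gauss_dvdpr.
have : size (d %/ G) == 1.
  apply: contraT => /closed_rootP [s /eqP ds].
  have [v vs /dvd_cofactor /dvdpP [w vE]] := nocommon s.
  by move: vs; rewrite vE rootM /root ds eqxx orbT.
rewrite size_poly_eq1 => unitG.
by rewrite dE (eqp_dvdl _ (eqp_mulr _ unitG)) mul1r dvdp_gcdr.
Qed.

Lemma nonroot_off_finite (F : closedFieldType) (p : {poly F}) :
  p != 0 -> exists bad : seq F, forall s, s \notin bad -> p.[s] != 0.
Proof.
move=> p0; have [r pE] := closed_field_poly_normal p; exists r => s sr.
by rewrite pE hornerZ mulf_neq0 ?lead_coef_eq0 // -rootE root_prod_XsubC.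
Qed.

(** * Bordered matrices *)

(** A minor of C P^-1 B as a Schur complement; the sign of the lower left block
makes the determinants agree without a sign correction. *)
Definition bordered (F : pzRingType) p m n k (P : 'M[F]_n) (B : 'M[F]_(n, m))
    (C : 'M[F]_(p, n)) (f : 'I_k -> 'I_p) (g : 'I_k -> 'I_m) : 'M[F]_(n + k) :=
  block_mx P (colsub g B) (- rowsub f C) 0.

Lemma det_bordered (F : fieldType) p m n k (P : 'M[F]_n) (B : 'M[F]_(n, m))
    (C : 'M[F]_(p, n)) (f : 'I_k -> 'I_p) (g : 'I_k -> 'I_m) :
  P \in unitmx ->
  \det (bordered P B C f g) = \det P * \det (mxsub f g (C *m invmx P *m B)).
Proof.
move=> uP; set Cf := rowsub f C.
have -> : bordered P B C f g = block_mx 1%:M 0 (- Cf *m invmx P) 1%:M *m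
    block_mx P (colsub g B) 0 (mxsub f g (C *m invmx P *m B)).
  rewrite mulmx_block !mul1mx !mul0mx ?mulmx0 !addr0 mulmxKV //.
  by rewrite mxsub_mul -mul_rowsub_mx !mulNmx addNr.
by rewrite det_mulmx det_lblock det_ublock !det1 !mul1r.
Qed.

(** [k] columns of [B] span a complement of the column space of [P]: modulo that
space, i.e. after multiplication by a basis of the left kernel of [P], [B] has
full row rank, so [k] of its columns form an invertible matrix. *)
Lemma complete_colspace (F : fieldType) m n k (P : 'M[F]_n) (B : 'M[F]_(n, m)) :
  (k + \rank P)%N = n ->
  (forall x : 'rV_n, x *m P = 0 -> x *m B = 0 -> x = 0) ->
  exists g : 'I_k -> 'I_m,
    (forall x : 'rV_n, x *m P = 0 -> x *m colsub g B = 0 -> x = 0) /\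
    (forall (y : 'cV_k) (z : 'cV_n), colsub g B *m y = P *m z -> y = 0).
Proof.
move=> kP PB.
have {kP} : k = \rank (kermx P) by rewrite mxrank_ker -[X in (X - _)%N]kP addnK.
move=> ?; subst k; set K := row_base (kermx P).
have KP : K *m P = 0 by apply/sub_kermxP; rewrite eq_row_base.
have freeK : row_free K := row_base_free _.
have full : row_full (K *m B)^T.
  rewrite /row_full mxrank_tr; change (row_free (K *m B)).
  apply/inj_row_free => x; rewrite mulmxA => xKB.
  have xK : x *m K = 0 by apply: PB => //; rewrite -mulmxA KP mulmx0.
  by rewrite -[x](mulmxKp freeK) xK mul0mx.
have uKB := fullrowsub_unit full.
set g := fullrankfun full in uKB; exists g.
have {}uKB : K *m colsub g B \in unitmx.
  by rewrite mulmx_colsub -unitmx_tr trmx_mxsub.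
split=> [x xP xB | y z yz].
- have /submxP [w xw] : (x <= K)%MS by rewrite eq_row_base; apply/sub_kermxP.
  have w0 : w = 0 by rewrite -[w](mulmxK uKB) mulmxA -xw xB mul0mx.
  by rewrite xw w0 mul0mx.
- by rewrite -[y](mulKmx uKB) -(mulmxA K) yz (mulmxA K) KP mul0mx mulmx0.
Qed.

(** For (x, y) in the left kernel, y vanishes because the chosen rows of [C] are
independent modulo the row space of [P], and then x vanishes because the chosen
columns of [B] complete the column space of [P]. *)
Lemma bordered_unitmx (F : fieldType) p m n k (P : 'M[F]_n) (B : 'M[F]_(n, m))
    (C : 'M[F]_(p, n)) :
  (k + \rank P)%N = n ->
  (forall x : 'rV_n, x *m P = 0 -> x *m B = 0 -> x = 0) ->
  (forall x : 'rV_n, x *m P^T = 0 -> x *m C^T = 0 -> x = 0) ->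
  exists (f : 'I_k -> 'I_p) (g : 'I_k -> 'I_m), bordered P B C f g \in unitmx.
Proof.
move=> kP PB PC.
have [g [g_full g_free]] := complete_colspace kP PB.
have kPT : (k + \rank P^T)%N = n by rewrite mxrank_tr.
have [f [f_full f_free]] := complete_colspace kPT PC.
exists f, g; rewrite -row_free_unit; apply/inj_row_free => v.
rewrite -[v]hsubmxK; set x := lsubmx v; set y := rsubmx v.
rewrite mul_row_block mulmx0 addr0 mulmxN => /eqP.
rewrite row_mx_eq0 => /andP [/eqP /subr0_eq xP /eqP xB].
have y0 : y = 0.
  apply: trmx_inj; rewrite trmx0; apply: (f_free _ x^T).
  by rewrite -trmx_mul xP trmx_mul trmx_mxsub.
rewrite y0 mul0mx in xP.
by rewrite y0 (g_full x) ?row_mx0.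
Qed.

(** * Controllability, at infinity included *)

(** The Popov-Belevitch-Hautus test in projective form. For (a, b) <> 0, a
vector x is in the left kernel of a E - b A exactly when x E = b y and
x A = a y for some y; the points s and infinity are (a, b) = (s, 1) and (1, 0).
Keeping y treats both cases at once. Observability is this property of E^T, A^T,
C^T. *)
Definition controllable (F : fieldType) n m (E A : 'M[F]_n)
    (B : 'M[F]_(n, m)) :=
  forall a b (x y : 'rV_n),
    x *m E = b *: y -> x *m A = a *: y -> x *m B = 0 -> x = 0.

Lemma controllable_finite (F : fieldType) n m (E A : 'M[F]_n)
    (B : 'M[F]_(n, m)) :
  controllable E A B -> forall s (x : 'rV_n),
  x *m (s *: E - A) = 0 -> x *m B = 0 -> x = 0.
Proof.
move=> ctrl s x; rewrite mulmxBr -scalemxAr => /subr0_eq xA.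
by apply: (ctrl s 1 x (x *m E)); rewrite ?scale1r.
Qed.

Lemma controllable_infty (F : fieldType) n m (E A : 'M[F]_n)
    (B : 'M[F]_(n, m)) :
  controllable E A B -> forall x : 'rV_n, x *m E = 0 -> x *m B = 0 -> x = 0.
Proof.
by move=> ctrl x xE; apply: (ctrl 1 0 x (x *m A)); rewrite ?scale1r ?scale0r.
Qed.

(** From x (lam E - A) = (lam b - a) y and x B = 0 one gets
(lam b - a) y (lam E - A)^-1 B = 0 at every point. If lam b = a at one of them,
x (lam E - A) = 0 and so x = 0; otherwise y annihilates every column of [K], so
y = 0 and x annihilates the whole pencil. *)
Lemma krylov_controllable (F : fieldType) n m k (E A : 'M[F]_n)
    (B : 'M[F]_(n, m)) (lam : 'I_k -> F) (r : 'I_k -> 'cV[F]_m)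
    (K : 'M[F]_(n, k)) :
  (exists s, s *: E - A \in unitmx) ->
  (forall j, lam j *: E - A \in unitmx) ->
  (forall j, col j K = invmx (lam j *: E - A) *m B *m r j) ->
  row_free K -> controllable E A B.
Proof.
move=> [s us] ulam colK freeK a b x y xE xA xB.
have xP t : x *m (t *: E - A) = (t * b - a) *: y.
  by rewrite mulmxBr -scalemxAr xE xA scalerA scalerBl.
have inj0 t : t *: E - A \in unitmx -> x *m (t *: E - A) = 0 -> x = 0.
  by move=> ut xP0; rewrite -[x](mulmxK ut) xP0 mul0mx.
case: (pickP (fun j => lam j * b - a == 0)) => [j /eqP lamj | lam0].
  by apply: (inj0 (lam j)) => //; rewrite xP lamj scale0r.
have yK : y *m K = 0.
  apply/matrixP => i j; rewrite (ord1 i); have lamj := negbT (lam0 j).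
  have : (lam j * b - a) *: (y *m col j K) = 0.
    by rewrite scalemxAl -xP colK !mulmxA mulmxK // xB mul0mx.
  move/eqP; rewrite scaler_eq0 (negPf lamj) colE mulmxA -colE.
  move=> /eqP /matrixP /(_ 0 0).
  by rewrite !mxE.
have y0 : y = 0 by rewrite -[y](mulmxKp freeK) yK mul0mx.
by apply: (inj0 s) => //; rewrite xP y0 scaler0.
Qed.

(** * The McMillan degree of a controllable and observable descriptor system *)

(** Multiplying the last [k] columns by [s] makes [s] a factor of each of the
first [n] rows. *)
Lemma det_border_scale (F : comNzRingType) n k (s : F) (X : 'M[F]_n)
    (Y : 'M[F]_(n, k)) (Z : 'M[F]_(k, n)) :
  \det (block_mx (s *: X) Y Z 0) * s ^+ k = s ^+ n * \det (block_mx X Y Z 0).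
Proof.
have eqM : block_mx (s *: X) Y Z 0 *m block_mx 1%:M 0 0 s%:M =
    block_mx s%:M 0 0 1%:M *m block_mx X Y Z 0.
  rewrite !mulmx_block !mulmx1 !mulmx0 !mul0mx !mul1mx !addr0 !add0r.
  by rewrite !mul_scalar_mx mul_mx_scalar.
have /(congr1 (fun M => \det M)) := eqM.
by rewrite !det_mulmx !det_ublock !det1 !det_scalar mul1r mulr1.
Qed.

Section McMillanDegree.
Variables (R : realType) (p m n : nat).
Local Notation K := R[i].
Variables (E A : 'M[K]_n) (B : 'M[K]_(n, m)) (C : 'M[K]_(p, n)).
Variable H : K -> 'M[K]_(p, m).
Hypothesis regEA : exists s, s *: E - A \in unitmx.
Hypothesis HE : forall s, s *: E - A \in unitmx ->
  H s = C *m invmx (s *: E - A) *m B.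

Let charp : {poly K} := pencil_det E (- A).

Definition bordered_num k (f : 'I_k -> 'I_p) (g : 'I_k -> 'I_m) : {poly K} :=
  pencil_det (block_mx E 0 0 0) (bordered (- A) B C f g).

Lemma horner_bordered_num k (f : 'I_k -> 'I_p) (g : 'I_k -> 'I_m) s :
  (bordered_num f g).[s] = \det (bordered (s *: E - A) B C f g).
Proof.
by rewrite horner_pencil_det scale_block_mx add_block_mx !scaler0 !add0r.
Qed.

Lemma size_bordered_num k (f : 'I_k -> 'I_p) (g : 'I_k -> 'I_m) :
  (size (bordered_num f g) <= (\rank E).+1)%N.
Proof.
by apply: leq_trans (size_pencil_det _ _) _; rewrite rank_diag_block_mx mxrank0
  addn0.
Qed.

Lemma charp_neq0 : charp != 0.
Proof.
have [s us] := regEA; apply/eqP => /(congr1 (horner^~ s)).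
by rewrite horner_pencil_det horner0; apply/eqP; rewrite -unitfE -unitmxE.
Qed.

Let invlc : K := (lead_coef charp)^-1.
Let den : {poly K} := invlc *: charp.

Lemma invlc_neq0 : invlc != 0.
Proof. by rewrite invr_eq0 lead_coef_eq0 charp_neq0. Qed.

Lemma minor_numerator_bordered k (f : 'I_k -> 'I_p) (g : 'I_k -> 'I_m) :
  minor_numerator H den f g (invlc *: bordered_num f g).
Proof.
have [bad badP] := nonroot_off_finite charp_neq0; exists bad => s /badP.
rewrite horner_pencil_det -unitfE -unitmxE => us.
by rewrite !hornerZ horner_bordered_num det_bordered // horner_pencil_det HE //
  mulrA.
Qed.

Lemma minor_numeratorE den' k (f : 'I_k -> 'I_p) (g : 'I_k -> 'I_m) num' :
  minor_numerator H den' f g num' ->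
  den' * (invlc *: bordered_num f g) = den * num'.
Proof.
have [bad1 eq1] := minor_numerator_bordered f g; case=> bad2 eq2.
apply: (@poly_eq_off_finite _ (bad1 ++ bad2)) => s.
rewrite mem_cat negb_or => /andP [/eq1 e1 /eq2 e2].
by rewrite !hornerM -e1 -e2 mulrCA.
Qed.

Hypothesis ctrl : controllable E A B.
Hypothesis obsv : controllable E^T A^T C^T.

(** The order of the minor, i.e. the defect of s E - A, depends on s. *)
Lemma bordered_num_no_common_root s :
  exists k (f : 'I_k -> 'I_p) (g : 'I_k -> 'I_m), ~~ root (bordered_num f g) s.
Proof.
set P := s *: E - A.
have kP : (n - \rank P + \rank P)%N = n by rewrite subnK // rank_leq_row.
have obsvP (x : 'rV_n) : x *m P^T = 0 -> x *m C^T = 0 -> x = 0.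
  by rewrite linearB linearZ; apply: (controllable_finite obsv).
have [f [g ufg]] := bordered_unitmx kP (controllable_finite ctrl (s := s))
  obsvP.
by exists (n - \rank P)%N, f, g; rewrite rootE horner_bordered_num -unitfE
  -unitmxE.
Qed.

(** A minor of order n - rank E with a bordered matrix that is invertible at
infinity has the largest possible degree. *)
Lemma size_bordered_num_attained :
  exists k (f : 'I_k -> 'I_p) (g : 'I_k -> 'I_m),
    size (bordered_num f g) = (\rank E).+1.
Proof.
have kE : (n - \rank E + \rank E)%N = n by rewrite subnK // rank_leq_row.
exists (n - \rank E)%N; set k := (n - _)%N in kE *.
have [f [g ufg]] := bordered_unitmx kE (controllable_infty ctrl)
  (controllable_infty obsv).
exists f, g; apply/eqP; rewrite eqn_leq size_bordered_num /= ltnNge.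
have num_r : (bordered_num f g)`_(\rank E) = \det (bordered E B C f g).
  (* With w = 1/s, dividing the first n rows by s and multiplying the last k
     columns by s turns s E - A into E - w A. *)
  pose q := pencil_det (block_mx (- A) 0 0 0) (bordered E B C f g).
  transitivity q.[0]; last by rewrite horner_pencil_det scale0r add0r.
  apply: coef_reversed (size_bordered_num f g) _ => s s0.
  rewrite horner_bordered_num horner_pencil_det scale_block_mx add_block_mx.
  rewrite !scaler0 !add0r.
  apply: (mulIf (expf_neq0 k s0)); rewrite mulrAC -exprD.
  have -> : (\rank E + k = n)%N by rewrite addnC.
  have -> : s *: E - A = s *: (s^-1 *: - A + E).
    by rewrite scalerDr scalerA mulfV // scale1r addrC.
  exact: det_border_scale.
apply/negP => /leq_sizeP /(_ _ (leqnn _)); rewrite num_r => det0.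
by rewrite unitmxE det0 unitr0 in ufg.
Qed.

Theorem mcmillan_degree_rank : mcmillan_degree H (\rank E).
Proof.
have den_monic : den \is monic.
  by rewrite monicE lead_coefZ mulVf // lead_coef_eq0 charp_neq0.
have den0 := monic_neq0 den_monic.
have size_den : (0 < size den <= (\rank E).+1)%N.
  by rewrite lt0n size_poly_eq0 den0 size_scale ?invlc_neq0 // size_pencil_det.
have {size_den} [size_den1 size_den2] := andP size_den.
have degE : (size den + (\rank E - (size den).-1) = (\rank E).+1)%N.
  by rewrite -[X in (X + _)%N](prednK size_den1) addSn subnKC // -ltnS
    prednK.
exists den, (\rank E - (size den).-1)%N; split.
- split; first by split=> // k f g; exists (invlc *: bordered_num f g);
    exact: minor_numerator_bordered.
  move=> den' [_ comm]; apply: dvdp_no_common_root => // s.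
  have [k [f [g nroot]]] := bordered_num_no_common_root s.
  exists (invlc *: bordered_num f g); first by rewrite rootZ ?invlc_neq0.
  have [num' /minor_numeratorE ->] := comm k f g.
  exact: dvdp_mulr.
- split=> [k f g num /minor_numeratorE /(mulfI den0) <- |].
    by rewrite degE size_scale ?invlc_neq0 // size_bordered_num.
  have [k [f [g sz]]] := size_bordered_num_attained.
  exists k, f, g, (invlc *: bordered_num f g); split.
    exact: minor_numerator_bordered.
  by rewrite degE size_scale ?invlc_neq0.
- by rewrite subnKC // -ltnS prednK.
Qed.

End McMillanDegree.
(** * Compressions U X V with U of full column rank, V of full row rank *)

Lemma mxrank_mul_full_free (F : fieldType) q n k (U : 'M[F]_(q, n))
    (X : 'M[F]_n) (V : 'M[F]_(n, k)) :
  row_full U -> row_free V -> \rank (U *m X *m V) = \rank X.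
Proof. by move=> fullU freeV; rewrite mxrankMfree // eqmxMfull. Qed.

Lemma mpinv_mulmx (F : numClosedFieldType) q n (U : 'M[F]_(q, n)) :
  row_full U -> mpinv U *m U = 1%:M.
Proof.
move=> /row_fullP [U' U'U]; have [UXU _ _ _] := mpinvP U.
by rewrite -[LHS]mul1mx -U'U -mulmxA (mulmxA U) UXU.
Qed.

Lemma mulmx_mpinv (F : numClosedFieldType) n k (V : 'M[F]_(n, k)) :
  row_free V -> V *m mpinv V = 1%:M.
Proof.
move=> /row_freeP [V' VV']; have [VXV _ _ _] := mpinvP V.
by rewrite -[LHS]mulmx1 -VV' mulmxA VXV.
Qed.

(** In M M^+ M = M with M = U P V, the outer factors U and V cancel. *)
Lemma mpinv_sandwich (F : numClosedFieldType) q n k (U : 'M[F]_(q, n))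
    (P : 'M[F]_n) (V : 'M[F]_(n, k)) :
  row_full U -> row_free V -> P \in unitmx ->
  V *m mpinv (U *m P *m V) *m U = invmx P.
Proof.
move=> /row_fullP [U' U'U] /row_freeP [V' VV'] uP.
set X := mpinv _; have [MXM _ _ _] := mpinvP (U *m P *m V).
have PXP : P *m (V *m X *m U) *m P = P.
  have /(congr1 (fun M => U' *m M *m V')) := MXM.
  by rewrite -/X !mulmxA U'U mul1mx -!mulmxA VV' mulmx1 !mulmxA.
rewrite -[LHS](mulmxK uP) -[X in X *m _](mulKmx uP) (mulmxA P) PXP.
by rewrite mulVmx // mul1mx.
Qed.

(** * Factorization of the Loewner matrices *)

(** The hypothesis on [X] covers both Loewner matrices: [X] is [E] for
[a = b = 1], and [A] for [(a, b) = (mu, lam)]. *)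
Lemma resolvent_divided_difference (F : fieldType) n (E A X : 'M[F]_n)
    (a b mu lam : F) (u : 'rV[F]_n) (v : 'cV[F]_n) :
  mu != lam -> mu *: E - A \in unitmx -> lam *: E - A \in unitmx ->
  a *: (lam *: E - A) - b *: (mu *: E - A) = (lam - mu) *: X ->
  (a * (u *m invmx (mu *: E - A) *m v) 0 0
   - b * (u *m invmx (lam *: E - A) *m v) 0 0) / (mu - lam) =
  - (u *m invmx (mu *: E - A) *m X *m (invmx (lam *: E - A) *m v)) 0 0.
Proof.
move=> ne umu ulam abX; set Fm := invmx _; set Fl := invmx _.
have FX : a *: Fm - b *: Fl = (lam - mu) *: (Fm *m X *m Fl).
  rewrite scalemxAl scalemxAr -abX mulmxBr mulmxBl -!scalemxAr -!scalemxAl.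
  by rewrite mulmxK // mulVmx // mul1mx.
have ne0 : mu - lam != 0 by rewrite subr_eq0.
have entry (M N : 'M[F]_1) : a * M 0 0 - b * N 0 0 = (a *: M - b *: N) 0 0.
  by rewrite !mxE.
apply: (canLR (mulfK ne0)); rewrite entry scalemxAl scalemxAr scalemxAl.
rewrite scalemxAr -mulmxBl -mulmxBr FX -scalemxAr -scalemxAl !mulmxA mxE.
by rewrite mulNr -mulrN opprB mulrC.
Qed.

Section LoewnerFactorization.
Variables (R : realType) (p m n q k : nat).
Variables (S : linear_system R p m n) (D : tangential_data R p m q k).
Local Notation H := (transfer S).
Local Notation KL := (krylovL D S).
Local Notation KR := (krylovR D S).
Local Notation E := (toC (sysE S)).
Local Notation A := (toC (sysA S)).
Local Notation B := (toC (sysB S)).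
Local Notation C := (toC (sysC S)).

Lemma row_krylovL i : row i KL = (ldir D i)^T *m C *m resolvent S (lpt D i).
Proof. by apply/rowP => a; rewrite !mxE. Qed.

Lemma col_krylovR j : col j KR = resolvent S (rpt D j) *m B *m rdir D j.
Proof. by apply/colP => a; rewrite !mxE. Qed.

Lemma loewnerW_factor : loewnerW D H = C *m KR.
Proof.
apply/matrixP => a j; rewrite mxE.
transitivity (col j (C *m KR) a 0); last by rewrite mxE.
by rewrite colE -mulmxA -colE col_krylovR /right_value /transfer !mulmxA.
Qed.

Lemma loewnerV_factor : loewnerV D H = KL *m B.
Proof.
apply/matrixP => i b; rewrite mxE.
transitivity (row i (KL *m B) 0 b); last by rewrite mxE.
by rewrite row_mul row_krylovL /left_value /transfer !mulmxA.
Qed.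

Hypothesis hdist : distinct_points D.
Hypothesis hdef : defined_at_points D S.

Lemma divided_difference_factor a b X i j :
  a *: sys_pencil S (rpt D j) - b *: sys_pencil S (lpt D i) =
    (rpt D j - lpt D i) *: X ->
  (a * (left_value D H i *m rdir D j) 0 0
   - b * ((ldir D i)^T *m right_value D H j) 0 0) / (lpt D i - rpt D j) =
  - (KL *m X *m KR) i j.
Proof.
move=> abX; have [_ _ ne] := hdist; have [uL uR] := hdef.
have -> : (KL *m X *m KR) i j = (row i KL *m X *m col j KR) 0 0.
  by rewrite -row_mul colE mulmxA -colE -row_mul !mxE.
rewrite row_krylovL col_krylovR -(mulmxA (resolvent _ _)).
rewrite -(resolvent_divided_difference _ _ (ne i j) (uL i) (uR j) abX).
by rewrite /left_value /right_value /transfer !mulmxA.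
Qed.

Lemma loewnerL_factor : loewnerL D H = - (KL *m E *m KR).
Proof.
apply/matrixP => i j; rewrite mxE [RHS]mxE.
rewrite -(@divided_difference_factor 1 1) ?mul1r // !scale1r /sys_pencil.
by rewrite opprB addrA subrK -scalerBl.
Qed.

Lemma loewnerLs_factor : loewnerLs D H = - (KL *m A *m KR).
Proof.
apply/matrixP => i j; rewrite mxE [RHS]mxE [_ * rpt D j]mulrC.
rewrite -(@divided_difference_factor (lpt D i) (rpt D j)) //.
rewrite /sys_pencil !scalerBr !scalerA [rpt D j * _]mulrC opprB addrC.
by rewrite addrA subrK -scalerBl.
Qed.

Hypothesis hrank : \rank (KL *m KR) = n.

Lemma krylovL_full : row_full KL.
Proof.
by rewrite /row_full eqn_leq rank_leq_col -[X in (X <= _)%N]hrank mxrankM_maxl.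
Qed.

Lemma krylovR_free : row_free KR.
Proof.
by rewrite /row_free eqn_leq rank_leq_row -[X in (X <= _)%N]hrank mxrankM_maxr.
Qed.

Hypothesis hreg : exists s, sys_pencil S s \in unitmx.

Lemma system_controllable : controllable E A B.
Proof.
apply: (krylov_controllable hreg hdef.2) krylovR_free => j.
exact: col_krylovR.
Qed.

(** The transpose of [KL] is the right Krylov matrix of the dual system. *)
Lemma system_observable : controllable E^T A^T C^T.
Proof.
have pencil_tr s : s *: E^T - A^T = (sys_pencil S s)^T.
  by rewrite linearB linearZ.
apply: (@krylov_controllable _ _ _ _ _ _ _ (lpt D) (ldir D) KL^T).
- by have [s us] := hreg; exists s; rewrite pencil_tr unitmx_tr.
- by move=> i; rewrite pencil_tr unitmx_tr; apply: hdef.1.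
- move=> i; rewrite -tr_row row_krylovL !trmx_mul trmxK trmx_inv pencil_tr.
  by rewrite mulmxA.
- by rewrite /row_free mxrank_tr; apply: krylovL_full.
Qed.

Lemma loewner_pencil_factor s :
  loewnerLs D H - s *: loewnerL D H = KL *m sys_pencil S s *m KR.
Proof.
rewrite loewnerL_factor loewnerLs_factor /sys_pencil mulmxBr mulmxBl.
by rewrite -scalemxAr -scalemxAl scalerN opprK addrC.
Qed.

Lemma transfer_loewner s : sys_pencil S s \in unitmx ->
  H s = loewnerW D H *m mpinv (loewnerLs D H - s *: loewnerL D H)
        *m loewnerV D H.
Proof.
move=> us; rewrite loewner_pencil_factor loewnerW_factor loewnerV_factor.
have sandwich := mpinv_sandwich krylovL_full krylovR_free us.
rewrite -[LHS]/(C *m invmx (sys_pencil S s) *m B) -sandwich.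
by rewrite !mulmxA.
Qed.

Lemma loewner_eigen lam (qhat phat : 'cV[R[i]]_n) :
  pencil_eigenvectors A E lam qhat phat ->
  pencil_eigenvalue (loewnerLs D H) (loewnerL D H) lam /\
  pencil_eigenvectors (loewnerLs D H) (loewnerL D H) lam
    (mpinv KR *m qhat) (phat^T *m mpinv KL)^T.
Proof.
move=> [q0 p0 Aq pA].
have VR := mulmx_mpinv krylovR_free; have UL := mpinv_mulmx krylovL_full.
have phatUL : phat^T *m mpinv KL *m KL = phat^T by rewrite -mulmxA UL mulmx1.
split.
  have [s us] := hreg; exists s; rewrite !loewner_pencil_factor.
  rewrite !mxrank_mul_full_free ?krylovL_full ?krylovR_free //.
  rewrite (mxrank_unit us) ltn_neqAle rank_leq_row andbT.
  apply: contra q0 => /eqP full.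
  have ulam : sys_pencil S lam \in unitmx.
    by rewrite -row_free_unit /row_free full.
  rewrite -[qhat](mulKmx ulam) /sys_pencil mulmxBl -scalemxAl Aq subrr.
  by rewrite mulmx0.
split.
- apply: contra q0 => /eqP Vq.
  by rewrite -[qhat]mul1mx -VR -mulmxA Vq mulmx0.
- apply: contra p0 => /eqP Up; apply/eqP/trmx_inj; rewrite trmx0.
  by rewrite -phatUL -[_ *m mpinv _]trmxK Up trmx0 mul0mx.
- rewrite loewnerLs_factor loewnerL_factor !mulNmx scalerN -!(mulmxA _ KR).
  by rewrite (mulmxA KR) VR mul1mx -!mulmxA Aq -scalemxAr.
- rewrite trmxK loewnerLs_factor loewnerL_factor !mulmxN scalerN !mulmxA.
  by rewrite phatUL pA !scalemxAl.
Qed.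

End LoewnerFactorization.

Lemma loewner_quadruple_congr (R : realType) p m q k
    (D : tangential_data R p m q k) (H H' : R[i] -> 'M[R[i]]_(p, m)) :
  (forall i, H' (lpt D i) = H (lpt D i)) ->
  (forall j, H' (rpt D j) = H (rpt D j)) ->
  loewner_quadruple D H' = loewner_quadruple D H.
Proof.
move=> eqL eqR.
have eqv i : left_value D H' i = left_value D H i by rewrite /left_value eqL.
have eqw j : right_value D H' j = right_value D H j by rewrite /right_value eqR.
have W : loewnerW D H' = loewnerW D H.
  by apply/matrixP => i j; rewrite mxE [RHS]mxE eqw.
have V : loewnerV D H' = loewnerV D H.
  by apply/matrixP => i j; rewrite mxE [RHS]mxE eqv.
have L : loewnerL D H' = loewnerL D H.
  by apply/matrixP => i j; rewrite mxE [RHS]mxE eqv eqw.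
have Ls : loewnerLs D H' = loewnerLs D H.
  by apply/matrixP => i j; rewrite mxE [RHS]mxE eqv eqw.
by rewrite /loewner_quadruple W V L Ls.
Qed.

Theorem lemma2p1 (R : realType) (p m n q k : nat)
    (S : linear_system R p m n) (D : tangential_data R p m q k)
    (hmin : minimal_realization S)
    (hdist : distinct_points D)
    (hdef : defined_at_points D S)
    (hqn : (n <= q)%N) (hkn : (n <= k)%N)
    (hrank : \rank (krylovL D S *m krylovR D S) = n) :
  let H := transfer S in
  let W := loewnerW D H in
  let L := loewnerL D H in
  let Ls := loewnerLs D H in
  let V := loewnerV D H in
  let KL := krylovL D S in
  let KR := krylovR D S in
  let A := toC (sysA S) in
  let B := toC (sysB S) in
  let C := toC (sysC S) in
  let E := toC (sysE S) in
  [/\ W = C *m KR,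
      L = - (KL *m E *m KR),
      Ls = - (KL *m A *m KR) &
      V = KL *m B]
  /\
  [/\ [/\ rank_revealing L KL (- E) KR,
          rank_revealing Ls KL (- A) KR &
          forall s, sys_pencil S s \in unitmx -> \rank (Ls - s *: L)%R = n],
      mcmillan_degree H (\rank L) /\ (\rank L = n <-> E \in unitmx),
      (forall n' (S' : linear_system R p m n'),
         defined_at_points D S' ->
         (forall i, transfer S' (lpt D i) = H (lpt D i)) ->
         (forall j, transfer S' (rpt D j) = H (rpt D j)) ->
         loewner_quadruple D (transfer S') = (W, L, Ls, V)) &
      forall s, sys_pencil S s \in unitmx ->
        H s = W *m mpinv (Ls - s *: L) *m V]
  /\
  forall (lam : R[i]) (qhat phat : 'cV[R[i]]_n),
    pencil_eigenvectors A E lam qhat phat ->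
    pencil_eigenvalue Ls L lam /\
    pencil_eigenvectors Ls L lam (mpinv KR *m qhat) (phat^T *m mpinv KL)^T.
Proof.
move=> H W L Ls V KL KR A B C E.
have hreg : exists s, sys_pencil S s \in unitmx.
  have [[bad badP] _] := hmin.
  have [s sb _] := exists_off_finite bad (oner_neq0 {poly R[i]}).
  by exists s; apply: badP.
have fullL := krylovL_full hrank; have freeR := krylovR_free hrank.
have LE : L = KL *m (- E) *m KR.
  by rewrite /L loewnerL_factor // mulmxN mulNmx.
have LsE : Ls = KL *m (- A) *m KR.
  by rewrite /Ls loewnerLs_factor // mulmxN mulNmx.
have rankL : \rank L = \rank E.
  by rewrite LE mxrank_mul_full_free // mxrank_opp.
split; last split.
- split.
  + exact: loewnerW_factor.
  + exact: loewnerL_factor.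
  + exact: loewnerLs_factor.
  + exact: loewnerV_factor.
- split.
  + split; last by move=> s us;
      rewrite loewner_pencil_factor // mxrank_mul_full_free // mxrank_unit.
    * by split; [| apply/eqP | apply/eqP | rewrite LE mxrank_mul_full_free].
    * by split; [| apply/eqP | apply/eqP | rewrite LsE mxrank_mul_full_free].
  + rewrite rankL; split.
      apply: (@mcmillan_degree_rank _ _ _ _ _ A B C) => //.
      * exact: system_controllable hdef hrank hreg.
      * exact: system_observable hdef hrank hreg.
    by rewrite -row_free_unit; split=> [/eqP | /eqP].
  + by move=> n' S' _; apply: loewner_quadruple_congr.
  + by move=> s; apply: transfer_loewner.
- by move=> lam qhat phat; apply: loewner_eigen.
Qed.
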